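(* Let $\mathcal{Y}$ be a finite set and let $\mu$ and $\pi$ be pmfs with full support on $\mathcal{Y}$, $\mu\ne\pi$. Let $\rho_1>1$ and consider the sequential test $(N^b,\delta_b)$ with threshold $a>1$ defined in the context. For every $a>1$, $$\alpha_a\triangleq\mathbb{P}_0\left[\delta_b(Y^{N^b})=1\right]\le\frac1a .$$ In addition, for any $0<\nu<1$ there is $a^*(\nu,\mu,\pi)$ such that for every $a>a^*(\nu,\mu,\pi)$, $$c_a\triangleq\mathbb{E}_1[N^b]\le\mathbb{E}_1[\tilde N^b]\le\frac{\log a}{\nu D(\mu\|\pi)},\qquad \kappa_a\triangleq\mathbb{E}_0[N^b]\le a(\log a)^{\rho_1},$$ $$\beta_a\triangleq\mathbb{P}_1\left[\delta_b(Y^{N^b})=0\right]=\mathbb{P}_1\left[\tilde N^b>a(\log a)^{\rho_1}\right]\le\frac{\mathbb{E}_1[\tilde N^b]}{a(\log a)^{\rho_1}}\le\frac{1}{\nu D(\mu\|\pi)\,a(\log a)^{\rho_1-1}} .$$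
   Context: All logarithms are natural; $D(p\|q)=\sum_y p(y)\log\frac{p(y)}{q(y)}$ is relative entropy. Under the null hypothesis $H_0$ (probability $\mathbb{P}_0$, expectation $\mathbb{E}_0$) the observations $Y_1,Y_2,\ldots$ are i.i.d. with pmf $\pi$; under the alternative $H_1$ (probability $\mathbb{P}_1$, expectation $\mathbb{E}_1$) they are i.i.d. with pmf $\mu$. Let $\gamma^{(n)}$ be the empirical distribution of $(Y_1,\ldots,Y_n)$. For $a>1$ define $$\tilde N^b=\min\{n\ge1:\ nD(\gamma^{(n)}\|\pi)>\log a+n^{2/3}+|\mathcal{Y}|\log(n+1)\}$$ (with $\tilde N^b=\infty$ if there is no such $n$), and $$N^b=\min\left(\tilde N^b,\lfloor a(\log a)^{\rho_1}\rfloor\right).$$ The test stops at time $N^b$, with decision $\delta_b(Y^{N^b})=1$ if $\tilde N^b\le a(\log a)^{\rho_1}$ and $\delta_b(Y^{N^b})=0$ if $\tilde N^b>a(\log a)^{\rho_1}$. *)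

(* Defs.v *)
From HB Require Import structures.
From mathcomp Require Export all_boot all_order all_algebra finmap.
From mathcomp Require Export all_classical all_reals all_analysis.

Set Implicit Arguments.
Unset Strict Implicit.
Unset Printing Implicit Defensive.
Import Order.TTheory GRing.Theory Num.Theory.
Import numFieldNormedType.Exports.

Local Open Scope classical_set_scope.
Local Open Scope ring_scope.

Section Distributions.
Variables (R : realType) (T : finType).

Definition is_pmf (p : T -> R) : Prop :=
  (forall y, 0 <= p y) /\ \sum_(y : T) p y = 1.

Definition full_support (p : T -> R) : Prop := forall y, 0 < p y.

(* Since [ln 0 = 0], a letter with [p y = 0] contributes 0, as is usual.  The
   real value is the relative entropy only when [q] charges every letter that
   [p] charges; below [q] always has full support. *)
Definition relative_entropy (p q : T -> R) : R :=
  \sum_(y : T) p y * ln (p y / q y).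

(* Samples are indexed from 0: [x i] stands for the observation Y_{i+1}. *)
Definition empirical (x : nat -> T) (n : nat) (y : T) : R :=
  #|[set i : 'I_n | x i == y]%SET|%:R / n%:R.

End Distributions.

Section SequentialTest.
Variables (R : realType) (T : finType) (pi : T -> R).

Definition crosses (a : R) (x : nat -> T) (n : nat) : bool :=
  (1 <= n)%N &&
  (ln a + n%:R `^ (2 / 3) + #|T|%:R * ln (n.+1)%:R
     < n%:R * relative_entropy (empirical R x n) pi).

(* [ex_minn] returns the least [n] with [crosses a x n]. *)
Definition Ntilde (a : R) (x : nat -> T) : \bar R :=
  if pselect (exists n, crosses a x n) is left ex then (ex_minn ex)%:R%:E
  else +oo%E.

Definition Nb (rho1 a : R) (x : nat -> T) : \bar R :=
  Order.min (Ntilde a x) (Num.floor (a * ln a `^ rho1))%:~R%:E.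

(* A function of the whole sample path [x], but its value depends only on the
   first [Nb rho1 a x] observations: the test has crossed by the truncation
   time or not. *)
Definition delta_b (rho1 a : R) (x : nat -> T) : nat :=
  if (Ntilde a x <= (a * ln a `^ rho1)%:E)%E then 1%N else 0%N.

End SequentialTest.

Section Observations.
Context {d : measure_display} {Omega : measurableType d} {R : realType}
  {T : finType}.

Definition sample_path (Y : nat -> Omega -> T) (w : Omega) : nat -> T :=
  fun i => Y i w.

(* [T] carries its discrete sigma-algebra.  Independence is the product rule
   over every finite set of indices and arbitrary events about each letter. *)
Definition iid (P : probability Omega R) (Y : nat -> Omega -> T) (p : T -> R) :
    Prop :=
  [/\ forall i (B : set T), measurable (Y i @^-1` B),
      forall i y, P (Y i @^-1` [set y]) = (p y)%:E
    & forall (J : {fset nat}) (B : nat -> set T),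
        P (\bigcap_(i in [set` J]) (Y i @^-1` B i)) =
        (\prod_(i <- J) P (Y i @^-1` B i))%E].

End Observations.

(* Main.v *)
Require Import Defs.
From mathcomp Require Import all_boot all_order all_algebra.
From mathcomp Require Import finmap all_classical all_reals all_analysis.
From mathcomp Require Import measurable_realfun ring lra.

Set Implicit Arguments.
Unset Strict Implicit.
Unset Printing Implicit Defensive.
Import Order.TTheory GRing.Theory Num.Theory.
Import numFieldNormedType.Exports.

Local Open Scope classical_set_scope.
Local Open Scope ring_scope.

(** Write [D] for [relative_entropy mu pi], [gamma] for the empirical
    distribution of the first [n] observations and [k] for the size of the
    alphabet.

    False alarms.  The test raises an alarm only if the threshold is crossed at
    some [n >= 1].  By the method of types ([prob_relative_entropy_gt]) the
    statistic [n * D(gamma || pi)] exceeds [t] with probability at most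
    [(n + 1)^(k - 1) * e^(- t)] under [pi].  For the threshold
    [t = ln a + n^(2/3) + k * ln (n + 1)] this is
    [a^-1 * e^(- n^(2/3)) / (n + 1)], at most [a^-1 / (n * (n + 1))] because [ln n <= n^(2/3)]; the sum over
    [n >= 1] telescopes to [a^-1] ([prob_Ntilde_le]).

    Delay.  By Gibbs' inequality [D(gamma || pi)] is at least the sample mean of
    [ln (mu y / pi y)], whose expectation under [mu] is [D]
    ([sum_ln_ratio_le_relative_entropy]).  When [n] exceeds [ln a / (v * D)] with
    [v < 1], and the sublinear penalties have become negligible with respect to
    [n], not having crossed at [n] is a lower large deviation of that sample
    mean, of probability at most [r^n] with [r < 1] ([prob_not_crosses_le]).
    Summing the tails [P1 (Ntilde > n)] gives an expected delay of at most
    [ln a / (v * D)] plus a constant, and the constant is absorbed by taking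
    [nu < v < 1] and [a] large ([expectation_Ntilde_le_ln]).

    The remaining claims are pointwise comparisons of [Nb] with [Ntilde] and with
    the truncation time, and Markov's inequality for [Ntilde]. *)

(** * Relative entropy *)

(** This is [ln u < u - 1] at [u = q / p].  Summed over an alphabet it gives
    Gibbs' inequality, the left-hand sides cancelling because both pmfs have
    mass 1.  The convention [0 * ln 0 = 0] makes it hold at [p = 0] too. *)
Lemma lt_sub_mul_ln (R : realType) (p q : R) :
  0 <= p -> 0 < q -> p != q -> p - q < p * ln (p / q).
Proof.
rewrite le_eqVlt => /predU1P[<- q0 _|p0 q0 pq].
  by rewrite mul0r sub0r oppr_lt0.
have -> : p - q = - (p * (q / p - 1)) by field; rewrite gt_eqF.
have -> : ln (p / q) = - ln (q / p) by rewrite -lnV ?posrE ?divr_gt0// invf_div.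
rewrite mulrN ltrN2 ltr_pM2l//.
have qp0 : 0 < q / p by rewrite divr_gt0.
have lnqp : ln (q / p) != 0.
  rewrite ln_eq0//; apply: contraNneq pq => qp1.
  by rewrite -(divfK (lt0r_neq0 p0) q) qp1 mul1r.
by have := expR_gt1Dx lnqp; rewrite lnK ?posrE// => ?; lra.
Qed.

Lemma le_sub_mul_ln (R : realType) (p q : R) :
  0 <= p -> 0 < q -> p - q <= p * ln (p / q).
Proof.
move=> p0 q0; have [->|pq] := eqVneq p q.
  by rewrite subrr divff ?gt_eqF// ln1 mulr0.
exact/ltW/lt_sub_mul_ln.
Qed.

Section RelativeEntropy.
Context {R : realType} {T : finType}.
Implicit Types p q f : T -> R.

Lemma pmf_card_gt0 p : is_pmf p -> (0 < #|T|)%N.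
Proof.
move=> [_ p1]; rewrite lt0n; apply/eqP => /fintype0 T0.
by move: p1; rewrite big1 => [/eqP|y _]; [rewrite eq_sym oner_eq0|case: (T0 y)].
Qed.

Lemma relative_entropy_ge0 p q :
  is_pmf p -> is_pmf q -> full_support q -> 0 <= relative_entropy p q.
Proof.
move=> [p0 p1] [_ q1] q0.
have -> : 0 = \sum_y (p y - q y) by rewrite sumrB p1 q1 subrr.
by apply: ler_sum => y _; exact: le_sub_mul_ln.
Qed.

Lemma relative_entropy_gt0 p q :
  is_pmf p -> is_pmf q -> full_support q -> p <> q -> 0 < relative_entropy p q.
Proof.
move=> [p0 p1] [_ q1] q0 pq.
have [y pqy] : exists y, p y != q y.
  apply: contrapT => /forallNP h; apply: pq; apply/funext => y.
  by apply/eqP/negPn/negP/h.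
have -> : 0 = \sum_y (p y - q y) by rewrite sumrB p1 q1 subrr.
rewrite /relative_entropy (bigD1 y)//= [ltRHS](bigD1 y)//=.
apply: ltr_leD; first exact: lt_sub_mul_ln.
by apply: ler_sum => z _; exact: le_sub_mul_ln.
Qed.

(** The two sides differ by the relative entropy of [p] with respect to [q].
    For an empirical [p] the left-hand side is an average of independent terms,
    so this turns a lower deviation of the nonlinear statistic into a lower
    deviation of a sample mean. *)
Lemma sum_ln_ratio_le_relative_entropy p q r :
  is_pmf p -> is_pmf q -> full_support q -> full_support r ->
  \sum_y p y * ln (q y / r y) <= relative_entropy p r.
Proof.
move=> pp pq q0 r0; rewrite -subr_ge0.
suff -> : relative_entropy p r - \sum_y p y * ln (q y / r y)
    = relative_entropy p q by exact: relative_entropy_ge0.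
rewrite -sumrB; apply: eq_bigr => y _.
have := pp.1 y; rewrite le_eqVlt => /predU1P[<-|py0].
  by rewrite !mul0r subrr.
rewrite -mulrBr !ln_div ?posrE//; ring.
Qed.

(** As a function of [l], the exponential moment is 1 with negative slope
    [- \sum_y p y * f y] at [l = 0].  An explicit small [l] works because
    [expR (- u) <= (1 + u)^-1 <= 1 - u + 2 * v ^+ 2] whenever
    [`|u| <= v <= 4^-1]. *)
Lemma exists_exponential_tilt p f :
  is_pmf p -> 0 < \sum_y p y * f y ->
  exists2 l : R, 0 < l & \sum_y p y * expR (- (l * f y)) < 1.
Proof.
move=> [p0 p1]; set m := \sum_y _ => m0.
pose K := \sum_y `|f y|.
have fK y : `|f y| <= K.
  by rewrite /K (bigD1 y)//= lerDl sumr_ge0.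
have mK : m <= K.
  rewrite -[leRHS]mul1r -p1 mulr_suml; apply: ler_sum => y _.
  by rewrite ler_wpM2l// (le_trans (ler_norm _)).
have K0 : 0 < K by exact: lt_le_trans mK.
(* This [l] makes the second-order term [2 * (l * K) ^+ 2] half of the
   first-order gain [l * m]. *)
pose l := m / (4 * K ^+ 2).
have l0 : 0 < l by rewrite divr_gt0// mulr_gt0// exprn_gt0.
have lK : l * K <= 4^-1.
  have -> : l * K = (m / K) / 4 by rewrite /l; field; rewrite gt_eqF.
  by rewrite -[leRHS]mul1r ler_wpM2r// ler_pdivrMr ?mul1r.
exists l => //.
apply: (@le_lt_trans _ _ (\sum_y (p y - l * (p y * f y)
    + 2 * l ^+ 2 * K ^+ 2 * p y))).
  apply: ler_sum => y _.
  have -> : p y - l * (p y * f y) + 2 * l ^+ 2 * K ^+ 2 * p y =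
    p y * (1 - l * f y + 2 * (l * K) ^+ 2) by ring.
  rewrite ler_wpM2l//.
  have lfy : `|l * f y| <= l * K by rewrite normrM gtr0_norm// ler_pM2l.
  move: lK lfy (expR_ge1Dx (l * f y)); rewrite expRN.
  move: (l * f y) (l * K) => u v v4; rewrite ler_norml => /andP[uv vu] e.
  have u0 : 0 < 1 + u by lra.
  apply: (@le_trans _ _ (1 + u)^-1); first by rewrite lef_pV2 ?posrE ?expR_gt0.
  rewrite -[leLHS]mul1r ler_pdivrMr//.
  have uv2 : u ^+ 2 <= v ^+ 2 by nra.
  nra.
rewrite big_split/= sumrB -!mulr_sumr p1 -/m mulr1.
have -> : 1 - l * m + 2 * l ^+ 2 * K ^+ 2 = 1 - l * m / 2.
  by rewrite /l; field; rewrite gt_eqF.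
by rewrite ltrBlDr ltrDl divr_gt0// mulr_gt0.
Qed.

End RelativeEntropy.

(** * The penalty terms of the threshold *)

Section Penalty.
Context {R : realType}.

Lemma powR23_cube_root (x : R) : 0 <= x ->
  [/\ 0 <= x `^ 3^-1, x = (x `^ 3^-1) ^+ 3 & x `^ (2 / 3) = (x `^ 3^-1) ^+ 2].
Proof.
move=> x0; split; first exact: powR_ge0.
- by rewrite -powR_mulrn ?powR_ge0// -powRrM mulVf// powRr1.
- by rewrite -powR_mulrn ?powR_ge0// -powRrM mulrC.
Qed.

(** The term [n `^ (2 / 3)] of the threshold enters the false-alarm bound only
    through this inequality, that is, through [expR (- n `^ (2 / 3)) <= n^-1]. *)
Lemma ln_le_powR23 (x : R) : 1 <= x -> ln x <= x `^ (2 / 3).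
Proof.
move=> x1; have x0 : 0 < x by lra.
(* With [u = x `^ (2 / 3)], [3 / 2 * ln u <= 3 / 2 * (u / expR 1) <= 3 / 4 * u]. *)
have e2 : 2 <= expR 1 :> R by have := expR_ge1Dx (1 : R); lra.
set u := x `^ (2 / 3); have u0 : 0 < u by exact: powR_gt0.
have -> : ln x = 3 / 2 * ln u by rewrite ln_powR; field.
have ue0 : 0 < u / expR 1 by rewrite divr_gt0// expR_gt0.
have : ln (u / expR 1) <= u / expR 1 - 1.
  by rewrite -{1}(subrKC 1 (u / expR 1)) le_ln1Dx//; lra.
rewrite ln_div ?posrE ?expR_gt0// expRK => h.
have : u / expR 1 <= u / 2 by rewrite ler_pM2l// lef_pV2 ?posrE//; lra.
lra.
Qed.

(** In terms of [s = n `^ 3^-1] the first penalty is [s ^+ 2], the second is at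
    most [3 * C * s ^+ 2] since [ln (1 + s ^+ 3) <= 3 * ln (1 + s)], and [n] is
    [s ^+ 3]. *)
Lemma penalty_le_linear (C eta : R) : 0 <= C -> 0 < eta ->
  exists n1 : nat, forall n, (n1 <= n)%N ->
    n%:R `^ (2 / 3) + C * ln n.+1%:R <= n%:R * eta.
Proof.
move=> C0 eta0; pose b := (1 + 3 * C) / eta.
have b0 : 0 < b by rewrite divr_gt0//; lra.
exists (Num.truncn (b ^+ 3)).+1 => n bn.
have {}bn : b ^+ 3 <= n%:R.
  by rewrite (le_trans (ltW (truncnS_gt _)))// ler_nat.
have n1 : 1 <= n%:R :> R.
  rewrite ler1n lt0n; apply: contraTneq bn => ->.
  by rewrite -ltNge exprn_gt0.
have [] := @powR23_cube_root n%:R (ler0n _ _).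
move: (n%:R `^ 3^-1) => s s0 ns ->; rewrite -natr1.
rewrite {}ns in n1 bn *.
have s1 : 1 <= s by rewrite -(@ler_pXn2r _ 3%N) ?nnegrE// expr1n.
have bs : b <= s by rewrite -(@ler_pXn2r _ 3%N) // nnegrE ltW.
have lns : ln (s ^+ 3 + 1) <= 3 * s ^+ 2.
  apply: (@le_trans _ _ (ln ((1 + s) ^+ 3))).
    by rewrite ler_ln ?posrE ?exprn_gt0//; [nra|lra..].
  rewrite lnXn; last by lra.
  have : ln (1 + s) <= s by rewrite le_ln1Dx//; lra.
  rewrite -[_ *+ 3]mulr_natl => ?; nra.
have : C * ln (s ^+ 3 + 1) <= C * (3 * s ^+ 2) by rewrite ler_wpM2l.
have : 1 + 3 * C <= s * eta by rewrite -ler_pdivrMr.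
move=> h1 h2.
have : (1 + 3 * C) * s ^+ 2 <= s * eta * s ^+ 2 by rewrite ler_wpM2r// sqr_ge0.
have -> : s ^+ 3 * eta = s * eta * s ^+ 2 by ring.
lra.
Qed.

End Penalty.

(** * Empirical distributions *)

Section Empirical.
Context {R : realType} {T : finType}.

Lemma sum_empirical (x : nat -> T) n (f : T -> R) : (0 < n)%N ->
  n%:R * (\sum_y empirical R x n y * f y) = \sum_(i < n) f (x i).
Proof.
move=> n0; rewrite mulr_sumr (partition_big (fun i : 'I_n => x i) predT)//=.
apply: eq_bigr => y _; rewrite /empirical mulrA mulrCA divff ?pnatr_eq0 -?lt0n//.
rewrite mulr1 mulr_natl.
under eq_bigr => i /eqP -> do idtac.
rewrite sumr_const; congr (_ *+ _).
by apply: eq_card => i; rewrite inE.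
Qed.

Lemma empirical_pmf (x : nat -> T) n : (0 < n)%N -> is_pmf (empirical R x n).
Proof.
move=> n0; split=> [y|]; first by rewrite divr_ge0.
have := sum_empirical x (fun=> 1) n0.
rewrite sumr_const card_ord.
under eq_bigr => y _ do rewrite mulr1.
by rewrite -[RHS]mulr1 => /mulfI; apply; rewrite pnatr_eq0 -lt0n.
Qed.

Lemma empirical_gt0 (x : nat -> T) n (i : 'I_n) : 0 < empirical R x n (x i).
Proof.
rewrite divr_gt0 ?ltr0n ?(leq_ltn_trans _ (ltn_ord i))// card_gt0.
by apply/set0Pn; exists i; rewrite inE.
Qed.

(** The test statistic is a generalized log-likelihood ratio: [q] is compared
    with the product law that fits the sample best. *)
Lemma expR_relative_entropy_empirical (x : nat -> T) n (q : T -> R) :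
  (0 < n)%N -> full_support q ->
  expR (n%:R * relative_entropy (empirical R x n) q) =
  \prod_(i < n) (empirical R x n (x i) / q (x i)).
Proof.
move=> n0 q0; rewrite (sum_empirical x (fun y => ln (empirical R x n y / q y)))//.
rewrite expR_sum; apply: eq_bigr => i _.
by rewrite lnK// posrE divr_gt0// empirical_gt0.
Qed.

Lemma eq_empirical (x x' : nat -> T) n :
  (forall i : 'I_n, x i = x' i) -> empirical R x n = empirical R x' n.
Proof.
move=> xx'; apply/funext => y; congr (_%:R / _).
by apply: eq_card => i; rewrite !inE xx'.
Qed.

Lemma eq_empirical_but_one (x x' : nat -> T) n (y0 : T) : (0 < n)%N ->
  (forall y, y != y0 -> empirical R x n y = empirical R x' n y) ->
  empirical R x n = empirical R x' n.
Proof.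
move=> n0 xx'; apply/funext => y; have [->|/xx'//] := eqVneq y y0.
have [_] := empirical_pmf x n0; have [_ <-] := empirical_pmf x' n0.
rewrite (bigD1 y0)//= [in RHS](bigD1 y0)//= (eq_bigr _ xx').
exact: addIr.
Qed.

End Empirical.

(** * Events determined by finitely many observations *)

Lemma content_le_sum_finType d (R : realFieldType) (U : semiRingOfSetsType d)
    (m : {content set U -> \bar R}) (I : finType) (A : set U) (F : I -> set U) :
  measurable A -> (forall i, measurable (F i)) -> A `<=` \bigcup_i F i ->
  (m A <= \sum_i m (F i))%E.
Proof.
move=> mA mF AF.
have := @content_sub_fsum _ _ _ m I setT A F finite_finset (fun i _ => mF i) mA AF.
rewrite (fsbigE (index_enum I))//; first last.
- by move=> i _; rewrite mem_index_enum.
- exact: index_enum_uniq.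
by under eq_bigl do rewrite in_setT.
Qed.

Section Sampling.
Context {d : measure_display} {Omega : measurableType d} {R : realType}
  {T : finType}.
Variables (P : probability Omega R) (Y : nat -> Omega -> T) (p : T -> R).
Hypothesis Yiid : iid P Y p.

Definition cylinder n (x : {ffun 'I_n -> T}) : set Omega :=
  [set w | forall i : 'I_n, Y i w = x i].

(** [insub] returns an index below [n] to ['I_n], which puts a cylinder in the
    form that the product rule of [iid] expects. *)
Lemma cylinderE n (x : {ffun 'I_n -> T}) :
  cylinder x = \bigcap_(i in [set` [fset i in iota 0 n]%fset])
    (Y i @^-1` [set y | Some y = omap x (insub i)]).
Proof.
apply/seteqP; split=> [w xw i /=|w xw i].
  rewrite !inE/= mem_iota/= add0n => ni.
  by rewrite insubT/= -(xw (Sub i ni)).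
have := xw i; rewrite /= !inE mem_iota/= add0n ltn_ord valK/=.
by move=> /(_ isT)[].
Qed.

Lemma measurable_cylinder n (x : {ffun 'I_n -> T}) : measurable (cylinder x).
Proof.
rewrite cylinderE; apply: fin_bigcap_measurable; first exact: finite_fset.
by move=> i _; case: Yiid.
Qed.

Lemma prob_cylinder n (x : {ffun 'I_n -> T}) :
  P (cylinder x) = (\prod_i p (x i))%:E.
Proof.
case: Yiid => _ Yp Yindep; rewrite cylinderE Yindep.
rewrite (perm_big (iota 0 n))/=; last first.
  by apply: uniq_perm; rewrite ?fset_uniq ?iota_uniq// => i; rewrite !inE.
rewrite -{1}[n]subn0 -/(index_iota 0 n) big_mkord -prodEFin.
apply: eq_bigr => i _; rewrite valK/= -(Yp i); congr (P _).
by apply/seteqP; split=> w /= => [[]|->].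
Qed.

Lemma measurable_prefix n (A : set Omega) :
  (forall w w', (forall i : 'I_n, Y i w = Y i w') -> A w -> A w') ->
  measurable A.
Proof.
move=> Aprefix.
have -> : A = \bigcup_(x in [set x | A `&` cylinder x !=set0]) @cylinder n x.
  apply/seteqP; split=> [w Aw|w [x [w' [Aw' xw']] xw]].
    have wcyl : cylinder [ffun i : 'I_n => Y i w] w by move=> i; rewrite ffunE.
    by exists [ffun i : 'I_n => Y i w] => //; exists w.
  by apply: Aprefix Aw' => i; rewrite xw xw'.
apply: fin_bigcup_measurable; first exact: finite_finset.
by move=> x _; exact: measurable_cylinder.
Qed.

(** Markov's inequality for the variable [c * \prod_(i < n) h (Y i)], whose
    expectation factors by independence.  With [h] a likelihood ratio it is a
    change of measure; with [h] an exponential it is Chernoff's bound. *)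
Lemma prob_le_prod_expectation n (A : set Omega) (c : R) (h : T -> R) :
  measurable A -> 0 <= c -> (forall y, 0 <= h y) ->
  (forall w, A w -> 1 <= c * \prod_(i < n) h (Y i w)) ->
  (P A <= (c * (\sum_y p y * h y) ^+ n)%:E)%E.
Proof.
move=> mA c0 h0 Ah.
pose F (x : {ffun 'I_n -> T}) := A `&` cylinder x.
have mF x : measurable (F x) by apply: measurableI => //; exact: measurable_cylinder.
apply: (@le_trans _ _ (\sum_x P (F x))%E).
  apply: content_le_sum_finType => // w Aw.
  by exists [ffun i : 'I_n => Y i w] => //; split=> // i; rewrite ffunE.
have -> : c * (\sum_y p y * h y) ^+ n
    = \sum_(x : {ffun 'I_n -> T}) c * \prod_i (p (x i) * h (x i)).
  rewrite -mulr_sumr -(bigA_distr_bigA (fun _ y => p y * h y)).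
  by rewrite prodr_const card_ord.
rewrite -sumEFin; apply: lee_sum => x _.
have Pcyl := prob_cylinder x.
have prod0 : 0 <= \prod_i p (x i) by rewrite -lee_fin -Pcyl.
rewrite big_split/= mulrCA.
have [->|/set0P[w [Aw xw]]] := eqVneq (F x) set0.
  by rewrite measure0 lee_fin !mulr_ge0// prodr_ge0.
apply: (@le_trans _ _ (P (cylinder x))).
  apply: le_measure; rewrite ?inE//; first exact: measurable_cylinder.
  exact: subIsetr.
rewrite Pcyl lee_fin ler_peMr//; apply: le_trans (Ah _ Aw) _.
by rewrite (eq_bigr (fun i => h (x i)))// => i _; rewrite xw.
Qed.

(** The method of types.  On the samples with a given empirical distribution
    [gamma], the statistic is the logarithm of the likelihood ratio of [gamma]
    to [p], so a change of measure from [p] to [gamma] bounds the probability by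
    [expR (- t)].  A type is determined by its counts off one letter [y0], which
    leaves at most [n.+1 ^ #|T|.-1] types.  The factor [n.+1] saved over the
    cruder count [n.+1 ^ #|T|] is what lets the false-alarm bounds be compared
    with the telescoping [(n * n.+1)^-1]. *)
Lemma prob_relative_entropy_gt n (t : R) :
  is_pmf p -> full_support p -> (0 < n)%N ->
  (P [set w | (t < n%:R * relative_entropy (empirical R (sample_path Y w) n) p)%R]
    <= (n.+1%:R ^+ #|T|.-1 * expR (- t))%:E)%E.
Proof.
move=> p_pmf p_full n0; set A := [set w | _].
have /card_gt0P[y0 _] := pmf_card_gt0 p_pmf.
pose count w y : 'I_n.+1 := inord #|[set i : 'I_n | Y i w == y]%SET|.
(* The count of [y0] is masked by [ord0], so that the possible types are the
   finite functions supported off [y0]. *)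
pose type w : {ffun T -> 'I_n.+1} :=
  [ffun y => if y == y0 then ord0 else count w y].
pose F tau := A `&` [set w | type w = tau].
have countE w y : empirical R (sample_path Y w) n y = (count w y)%:R / n%:R.
  congr (_%:R / _); rewrite inordK// ltnS (leq_trans (max_card _))//.
  by rewrite card_ord.
have prefix w w' : (forall i : 'I_n, Y i w = Y i w') ->
    empirical R (sample_path Y w) n = empirical R (sample_path Y w') n /\
    type w = type w'.
  move=> ww'; split; first exact: eq_empirical.
  apply/ffunP => y; rewrite !ffunE; case: ifP => // _; congr inord.
  by apply: eq_card => i; rewrite !inE ww'.
have mA : measurable A.
  by apply: (@measurable_prefix n) => w w' /prefix[e _]; rewrite /A/= e.
have mF tau : measurable (F tau).
  apply: (@measurable_prefix n) => w w' /prefix[e e'].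
  by rewrite /F/A/= e e'.
apply: (@le_trans _ _ (\sum_tau P (F tau))%E).
  by apply: content_le_sum_finType => // w Aw; exists (type w).
apply: (@le_trans _ _
    (\sum_(tau in pffun_on ord0 (predC1 y0) predT) (expR (- t))%:E)%E); last first.
  rewrite sumEFin sumr_const card_pffun_on card_ord cardC1.
  by rewrite -[_ *+ _]mulr_natl natrX.
rewrite [leRHS]big_mkcond/=; apply: lee_sum => tau _.
have [->|/set0P[w0 [_ w0tau]]] := eqVneq (F tau) set0.
  by rewrite measure0; case: ifP; rewrite ?lee_fin ?expR_ge0.
rewrite ifT; last first.
  apply/pffun_onP; split=> //; apply/supportP => y.
  by rewrite inE negbK -w0tau ffunE => ->.
pose gamma := empirical R (sample_path Y w0) n.
have -> : expR (- t) = expR (- t) * (\sum_y p y * (gamma y / p y)) ^+ n.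
  under eq_bigr do rewrite mulrC divfK ?gt_eqF//.
  by have [_ ->] := @empirical_pmf R _ (sample_path Y w0) _ n0; rewrite expr1n mulr1.
apply: prob_le_prod_expectation => //.
  by move=> y; rewrite divr_ge0 ?(ltW (p_full _))// divr_ge0.
move=> w [Aw wtau].
have -> : gamma = empirical R (sample_path Y w) n.
  apply: (eq_empirical_but_one (y0 := y0)) => // y yy0; rewrite !countE.
  have : type w0 y = type w y by rewrite w0tau wtau.
  by rewrite !ffunE (negbTE yy0) => ->.
rewrite -(expR_relative_entropy_empirical (sample_path Y w))// -expRD.
by rewrite -[leLHS]expR0 ler_expR addrC subr_ge0 ltW.
Qed.

End Sampling.

(** * The stopping time as a random variable *)

Section StoppingTime.
Context {d : measure_display} {Omega : measurableType d} {R : realType}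
  {T : finType}.
Variables (P : probability Omega R) (Y : nat -> Omega -> T) (p pi : T -> R).
Hypothesis Yiid : iid P Y p.

Lemma measurable_crosses (a : R) n :
  measurable [set w | crosses pi a (sample_path Y w) n].
Proof.
apply: (measurable_prefix Yiid (n := n)) => w w' ww'.
by rewrite /crosses/= (eq_empirical (x' := sample_path Y w')).
Qed.

Lemma measurable_not_crosses (a : R) n :
  measurable [set w | ~~ crosses pi a (sample_path Y w) n].
Proof.
rewrite (_ : [set w | _] = ~` [set w | crosses pi a (sample_path Y w) n]).
  exact/measurableC/measurable_crosses.
by apply/seteqP; split=> w /= /negP.
Qed.

End StoppingTime.

Section Ntilde.
Context {R : realType} {T : finType}.
Variables (pi : T -> R) (a : R).
Implicit Type x : nat -> T.

Lemma Ntilde_gtP x n :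
  (n%:R%:E < Ntilde pi a x)%E <-> forall m, (m <= n)%N -> ~~ crosses pi a x m.
Proof.
rewrite /Ntilde; case: pselect => [ex|nex].
  case: ex_minnP => k ck kmin; rewrite lte_fin ltr_nat; split=> [nk m mn|h].
    by apply: contraTN nk => /kmin km; rewrite -leqNgt (leq_trans km).
  by rewrite ltnNge; apply: contraL ck; exact: h.
split=> [_ m _|_]; last by rewrite ltry.
by apply: contra_notN nex => ?; exists m.
Qed.

Lemma crosses_of_Ntilde_le x (b : R) :
  (Ntilde pi a x <= b%:E)%E -> exists n, crosses pi a x n.+1.
Proof.
rewrite /Ntilde; case: pselect => [[n cn] _|nex]; last by rewrite leye_eq.
by exists n.-1; rewrite prednK//; case/andP: cn.
Qed.

Lemma Ntilde_ge0 x : (0 <= Ntilde pi a x)%E.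
Proof. by rewrite /Ntilde; case: pselect => //= ?; rewrite lee_fin. Qed.

(** A nonnegative extended integer is the number of integers below it.  This
    yields measurability and the tail-sum formula for the expectation. *)
Lemma Ntilde_series x : Ntilde pi a x =
  (\sum_(n <oo) (\1_[set x | (n%:R%:E < Ntilde pi a x)%E] x)%:E)%E.
Proof.
pose B n := [set x | (n%:R%:E < Ntilde pi a x)%E].
have sum_lt k : (k%:R%:E <= Ntilde pi a x ->
    \sum_(0 <= n < k) (\1_(B n) x)%:E = (k%:R : R)%:E)%E.
  move=> kN; rewrite (eq_big_nat _ _ (F2 := fun=> 1%E)); last first.
    move=> i /= ik; rewrite indicE mem_set//=; apply: lt_le_trans kN.
    by rewrite lte_fin ltr_nat.
  by rewrite sumEFin sumr_const_nat subn0.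
have ind0 n : (0 <= (\1_(B n) x)%:E :> \bar R)%E by rewrite lee_fin.
have [Noo|[k Nk]] : Ntilde pi a x = +oo%E \/
    exists k : nat, Ntilde pi a x = k%:R%:E.
- by rewrite /Ntilde; case: pselect => ?; [right; eexists|left].
- rewrite [LHS]Noo; apply/esym/eqyP => A A0.
  apply: (@le_trans _ _ (Num.truncn A).+1%:R%:E).
    by rewrite lee_fin ltW// truncnS_gt.
  by rewrite -sum_lt ?Noo ?leey//; exact: nneseries_lim_ge.
- rewrite [LHS]Nk (nneseries_split 0 k)// add0n sum_lt ?Nk// eseries0 ?adde0//.
  by move=> i ki _; rewrite indicE memNset//= Nk lte_fin ltr_nat ltnNge ki.
Qed.

End Ntilde.

Section NtildeLaw.
Context {d : measure_display} {Omega : measurableType d} {R : realType}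
  {T : finType}.
Variables (P : probability Omega R) (Y : nat -> Omega -> T) (p pi : T -> R).
Hypothesis Yiid : iid P Y p.
Variable a : R.

Let Nt w := Ntilde pi a (sample_path Y w).

Lemma measurable_Ntilde_gt n : measurable [set w | (n%:R%:E < Nt w)%E].
Proof.
have -> : [set w | (n%:R%:E < Nt w)%E] = \bigcap_(m in `I_n.+1)
    ~` [set w | crosses pi a (sample_path Y w) m].
  apply/seteqP; split=> [w /Ntilde_gtP h m /= mn|w h].
    by apply/negP/h.
  by apply/Ntilde_gtP => m mn; apply/negP/h.
apply: bigcap_measurable => [|m _]; first by exists 0%N.
apply: measurableC.
exact: measurable_crosses Yiid _ _.
Qed.

Lemma measurable_Ntilde : measurable_fun setT Nt.
Proof.
have -> : Nt = fun w => (\sum_(n <oo | n \in xpredT)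
    (\1_[set w | (n%:R%:E < Nt w)%E] w)%:E)%E.
  by apply/funext => w; rewrite /Nt Ntilde_series.
apply: ge0_emeasurable_sum => // n _.
apply/measurable_EFinP; apply: measurable_indic.
exact: measurable_Ntilde_gt.
Qed.

Lemma expectation_Ntilde :
  (\int[P]_w Nt w = \sum_(n <oo) P [set w | (n%:R%:E < Nt w)%E])%E.
Proof.
under eq_integral do rewrite /Nt Ntilde_series.
rewrite integral_nneseries//.
  apply: eq_eseriesr => n _; rewrite integral_indic ?setIT//.
  exact: measurable_Ntilde_gt.
move=> n; apply/measurable_EFinP.
exact: (measurable_indic (measurable_Ntilde_gt n)).
Qed.

(** The event [n < Ntilde] has probability at most 1 for [n < n0]; for later [n]
    it forces in particular the absence of a crossing at [n], and the geometric
    tail sums to at most [(1 - r)^-1]. *)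
Lemma expectation_Ntilde_le (n0 : nat) (r : R) : 0 <= r < 1 ->
  (forall n, (n0 <= n)%N ->
    (P [set w | ~~ crosses pi a (sample_path Y w) n] <= (r ^+ n)%:E)%E) ->
  (\int[P]_w Nt w <= (n0%:R + (1 - r)^-1)%:E)%E.
Proof.
move=> /andP[r0 r1] Pr; rewrite expectation_Ntilde (nneseries_split 0 n0)//.
rewrite add0n EFinD leeD//.
  rewrite (@le_trans _ _ (\sum_(0 <= n < n0) 1)%E)//.
    by apply: lee_sum => n _; exact: probability_le1 (measurable_Ntilde_gt n).
  by rewrite sumEFin sumr_const_nat subn0.
apply: (@le_trans _ _ (\sum_(n0 <= n <oo) (r ^+ n)%:E)%E).
  rewrite [leLHS]eseries_cond [leRHS]eseries_cond.
  apply: lee_nneseries => // n /= n0n.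
  apply: le_trans (Pr _ n0n); apply: le_measure; rewrite ?inE.
  - exact: measurable_Ntilde_gt.
  - exact: measurable_not_crosses Yiid _ _.
  - by move=> w /Ntilde_gtP; exact.
apply: (@le_trans _ _ (\sum_(0 <= n <oo) (r ^+ n)%:E)%E).
  rewrite [leRHS](nneseries_split 0 n0) ?add0n => [|*].
    by rewrite leeDr// sume_ge0// => *; rewrite lee_fin exprn_ge0.
  by rewrite lee_fin exprn_ge0.
apply: lime_le; first by apply: is_cvg_nneseries => *; rewrite lee_fin exprn_ge0.
apply: nearW => n; rewrite sumEFin lee_fin -[leRHS]mul1r ler_pdivlMr ?subr_gt0//.
have := subrX1 r n; rewrite big_mkord => rn.
have : 0 <= r ^+ n by exact: exprn_ge0.
by move: (\sum_(_ < _) _) rn => s; nra.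
Qed.

End NtildeLaw.

(** * False alarms *)

Section FalseAlarm.
Context {d : measure_display} {Omega : measurableType d} {R : realType}
  {T : finType}.
Variables (P : probability Omega R) (Y : nat -> Omega -> T) (pi : T -> R).
Hypotheses (Yiid : iid P Y pi) (pi_pmf : is_pmf pi) (pi_full : full_support pi).

(** With [t] the threshold, [n.+1 ^+ #|T|.-1 * expR (- t)] equals
    [a^-1 * expR (- n `^ (2 / 3)) / n.+1], and the exponential is at most
    [n^-1].  The bound is written as a difference so that it telescopes. *)
Lemma prob_crosses_le (a : R) n : 0 < a -> (0 < n)%N ->
  (P [set w | crosses pi a (sample_path Y w) n]
    <= (a^-1 * (n%:R^-1 - n.+1%:R^-1))%:E)%E.
Proof.
move=> a0 n0.
pose t := ln a + n%:R `^ (2 / 3) + #|T|%:R * ln n.+1%:R.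
rewrite (_ : [set w | _] = [set w |
    t < n%:R * relative_entropy (empirical R (sample_path Y w) n) pi]); last first.
  by apply/seteqP; split=> w; rewrite /crosses n0.
apply: (le_trans (prob_relative_entropy_gt Yiid t pi_pmf pi_full n0)).
have nR0 : 0 < n%:R :> R by rewrite ltr0n.
rewrite lee_fin /t !opprD !expRD !expRN expRM_natl !lnK ?posrE//.
have -> : n.+1%:R ^+ #|T| = n.+1%:R ^+ #|T|.-1 * n.+1%:R :> R.
  by rewrite -exprSr prednK// (pmf_card_gt0 pi_pmf).
have -> : n%:R^-1 - n.+1%:R^-1 = (n%:R * n.+1%:R)^-1 :> R.
  by rewrite -natr1; field; rewrite natr1 pnatr_eq0 (gt_eqF nR0).
have : (expR (n%:R `^ (2 / 3)))^-1 <= n%:R^-1 :> R.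
  rewrite lef_pV2 ?posrE ?expR_gt0// -{1}(lnK (x := n%:R)) ?posrE//.
  by rewrite ler_expR ln_le_powR23// ler1n.
move: (expR _) => e en.
have -> : n.+1%:R ^+ #|T|.-1 *
    (a^-1 * e^-1 * (n.+1%:R ^+ #|T|.-1 * n.+1%:R)^-1) = a^-1 * (e^-1 * n.+1%:R^-1).
  rewrite invfM; set u := n.+1%:R ^+ _.
  have u0 : u != 0 by rewrite expf_neq0// pnatr_eq0.
  transitivity ((u * u^-1) * (a^-1 * (e^-1 * n.+1%:R^-1))); first by ring.
  by rewrite divff// mul1r.
by rewrite ler_pM2l ?invr_gt0// invfM ler_pM2r ?invr_gt0// ltr0n.
Qed.

Lemma prob_Ntilde_le (a b : R) : 0 < a ->
  (P [set w | (Ntilde pi a (sample_path Y w) <= b%:E)%E] <= (a^-1)%:E)%E.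
Proof.
move=> a0.
pose F n := [set w | crosses pi a (sample_path Y w) n.+1].
apply: (@le_trans _ _ (\sum_(n <oo) P (F n))%E).
  apply: measure_sigma_subadditive => [n||w].
  - exact: measurable_crosses Yiid _ _.
  - rewrite -[X in measurable X]setTI.
    exact: emeasurable_fun_infty_c (measurable_Ntilde _ Yiid _) _.
  - by move=> /crosses_of_Ntilde_le[n cn]; exists n.
apply: lime_le; first exact: is_cvg_nneseries.
apply: nearW => k.
apply: (@le_trans _ _
    (\sum_(0 <= n < k) (a^-1 * (n.+1%:R^-1 - n.+2%:R^-1))%:E)%E).
  by apply: lee_sum => n _; exact: prob_crosses_le.
rewrite sumEFin lee_fin -mulr_sumr -[leRHS]mulr1 ler_pM2l ?invr_gt0//.
under eq_bigr do rewrite -opprB.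
rewrite sumrN telescope_sumr// opprB invr1.
by rewrite lerBlDr lerDl invr_ge0.
Qed.

End FalseAlarm.

(** * Expected delay under the alternative *)

Section Detection.
Context {R : realType} {T : finType}.
Variables (mu pi : T -> R).
Hypotheses (mu_pmf : is_pmf mu) (mu_full : full_support mu).
Hypotheses (pi_pmf : is_pmf pi) (pi_full : full_support pi).
Let D := relative_entropy mu pi.

(** Once [ln a <= n * (v * D)] and the penalties are below [n * eta], the
    absence of a crossing forces the sample mean of [ln (mu y / pi y)] down to
    [c], which lies strictly between [v * D] and its expectation [D]; Chernoff's
    bound applies.  The rate [r] and the rank [n1] depend on neither [a] nor the
    probability space. *)
Lemma prob_not_crosses_le (v : R) : v < 1 -> 0 < D ->
  exists r : R, 0 <= r < 1 /\ exists n1 : nat, forall (a : R) n,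
    (n1 <= n)%N -> (0 < n)%N -> ln a <= n%:R * (v * D) ->
    forall (d : measure_display) (Omega : measurableType d)
      (P : probability Omega R) (Y : nat -> Omega -> T), iid P Y mu ->
    (P [set w | ~~ crosses pi a (sample_path Y w) n] <= (r ^+ n)%:E)%E.
Proof.
move=> v1 D0; pose eta := (1 - v) / 2 * D.
have eta0 : 0 < eta by rewrite mulr_gt0// divr_gt0// subr_gt0.
pose c := v * D + eta.
pose f y := ln (mu y / pi y) - c.
have f0 : 0 < \sum_y mu y * f y.
  under eq_bigr do rewrite mulrBr.
  rewrite sumrB -mulr_suml mu_pmf.2 mul1r subr_gt0.
  rewrite -/(relative_entropy mu pi) -/D /c -ltrBrDl.
  by rewrite (_ : D - v * D = eta + eta) ?ltrDl// /eta; field.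
have [l l0 r1] := exists_exponential_tilt mu_pmf f0.
exists (\sum_y mu y * expR (- (l * f y))); split.
  by rewrite r1 andbT sumr_ge0// => y _; rewrite mulr_ge0 ?expR_ge0// ltW.
have [n1 pen] := @penalty_le_linear R #|T|%:R eta (ler0n _ _) eta0.
exists n1 => a n n1n n0 lna d Omega P Y Yiid.
rewrite -[_ ^+ n]mul1r.
apply: (prob_le_prod_expectation Yiid) => //.
  exact: measurable_not_crosses Yiid _ _.
move=> w /=; rewrite /crosses n0/= -leNgt => Dle.
rewrite mul1r -expR_sum -[leLHS]expR0 ler_expR sumrN -mulr_sumr oppr_ge0.
rewrite pmulr_rle0// sumrB sumr_const card_ord -mulr_natl subr_le0.
rewrite -(sum_empirical (sample_path Y w) (fun y => ln (mu y / pi y)))//.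
apply: (@le_trans _ _ (n%:R * relative_entropy (empirical R (sample_path Y w) n) pi)).
  by rewrite ler_wpM2l// sum_ln_ratio_le_relative_entropy//; exact: empirical_pmf.
apply: (le_trans Dle); have := pen _ n1n.
by rewrite /c mulrDr; lra.
Qed.

(** Crossing is likely from about [ln a / (v * D)] on, where [v] is halfway
    between [nu] and 1, and the bounded excess over that time is absorbed by the
    difference between [(v * D)^-1] and [(nu * D)^-1] as [ln a] grows. *)
Lemma expectation_Ntilde_le_ln (nu : R) : 0 < nu < 1 -> 0 < D ->
  exists astar : R, forall a : R, astar < a -> 1 < a ->
    forall (d : measure_display) (Omega : measurableType d)
      (P : probability Omega R) (Y : nat -> Omega -> T), iid P Y mu ->
    (\int[P]_w Ntilde pi a (sample_path Y w) <= (ln a / (nu * D))%:E)%E.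
Proof.
move=> /andP[nu0 nu1] D0; pose v := (1 + nu) / 2.
have v1 : v < 1 by rewrite /v; lra.
have v0 : 0 < v by rewrite /v; lra.
have [r [r01 [n1 Pr]]] := prob_not_crosses_le v1 D0.
pose gap := (nu * D)^-1 - (v * D)^-1.
have gap0 : 0 < gap.
  rewrite subr_gt0 ltf_pV2 ?posrE ?(mulr_gt0 v0 D0) ?(mulr_gt0 nu0 D0)//.
  by rewrite ltr_pM2r// /v; lra.
pose C := n1%:R + 1 + (1 - r)^-1.
exists (expR (C / gap)) => a Ca a1 d Omega P Y Yiid.
have lna0 : 0 < ln a by exact: ln_gt0.
have {}Ca : C <= ln a * gap.
  rewrite -ler_pdivrMr// -[leLHS]expRK ler_ln ?posrE ?expR_gt0 ?ltW//; lra.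
pose q := ln a / (v * D).
have q0 : 0 <= q by rewrite divr_ge0// ltW// mulr_gt0.
pose n0 := (n1 + (Num.truncn q).+1)%N.
apply: (@le_trans _ _ (n0%:R + (1 - r)^-1)%:E).
  apply: (expectation_Ntilde_le Yiid r01) => n n0n; apply: Pr => //.
  - exact: leq_trans (leq_addr _ _) n0n.
  - by apply: leq_trans n0n; rewrite /n0 addnS.
  - rewrite -ler_pdivrMr ?(mulr_gt0 v0 D0)// -/q (le_trans (ltW (truncnS_gt q)))//.
    by rewrite ler_nat (leq_trans _ n0n)// leq_addl.
rewrite lee_fin; have -> : ln a / (nu * D) = q + ln a * gap.
  by rewrite /q /gap mulrBr addrC subrK.
have /andP[qn _] := truncn_itv q0.
by rewrite /n0 natrD -natr1; rewrite /C in Ca; lra.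
Qed.

End Detection.

(** * Performance of the truncated test *)

(** Markov's inequality for a nonnegative variable that may be infinite. *)
Lemma prob_gt_le_expectation d (Omega : measurableType d) (R : realType)
    (P : probability Omega R) (X : Omega -> \bar R) (b : R) :
  measurable_fun setT X -> (forall w, 0 <= X w)%E -> 0 < b ->
  (P [set w | (b%:E < X w)%E] <= (\int[P]_w X w) / b%:E)%E.
Proof.
move=> mX X0 b0.
pose A := [set w | (b%:E < X w)%E]; rewrite -/A.
have mA : measurable A.
  rewrite -[X in measurable X]setTI; exact: emeasurable_fun_o_infty.
rewrite inver gt_eqF// lee_pdivlMr// muleC.
have -> : P A = (\int[P]_w (\1_A w)%:E)%E by rewrite integral_indic ?setIT.
rewrite -ge0_integralZl//.
- apply: ge0_le_integral => //.
  + by move=> w _; rewrite mule_ge0// lee_fin// ltW.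
  + apply: measurable_funeM; apply/measurable_EFinP; exact: measurable_indic.
  + move=> w _; rewrite indicE; have [wA|_] := boolP (w \in A).
      by rewrite mule1; apply: ltW; exact: set_mem wA.
    by rewrite mule0.
- by apply/measurable_EFinP; exact: measurable_indic.
- by rewrite lee_fin ltW.
Qed.

Theorem lemma2p1 (R : realType) (T : finType) (mu pi : T -> R)
    (mu_pmf : is_pmf mu) (mu_full : full_support mu)
    (pi_pmf : is_pmf pi) (pi_full : full_support pi) (mu_neq_pi : mu <> pi) :
  (forall (rho1 a : R), 1 < rho1 -> 1 < a ->
   forall (d : measure_display) (Omega : measurableType d)
     (Y : nat -> Omega -> T) (P0 : probability Omega R),
     iid P0 Y pi ->
     (P0 [set w | delta_b pi rho1 a (sample_path Y w) = 1%N] <= (a^-1)%:E)%E)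
  /\
  (forall nu : R, 0 < nu < 1 ->
   exists astar : R, forall a : R, astar < a -> 1 < a ->
   forall rho1 : R, 1 < rho1 ->
   forall (d : measure_display) (Omega : measurableType d)
     (Y : nat -> Omega -> T) (P0 P1 : probability Omega R),
     iid P0 Y pi -> iid P1 Y mu ->
     let Nt := fun w => Ntilde pi a (sample_path Y w) in
     let N := fun w => Nb pi rho1 a (sample_path Y w) in
     let delta := fun w => delta_b pi rho1 a (sample_path Y w) in
     let D := relative_entropy mu pi in
     let E1Nt := (\int[P1]_w Nt w)%E in
     let beta := P1 [set w | delta w = 0%N] in
     [/\ (\int[P1]_w N w <= E1Nt)%E,
         (E1Nt <= (ln a / (nu * D))%:E)%E
       & (\int[P0]_w N w <= (a * ln a `^ rho1)%:E)%E]
     /\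
     [/\ beta = P1 [set w | ((a * ln a `^ rho1)%:E < Nt w)%E],
         (beta <= E1Nt / (a * ln a `^ rho1)%:E)%E
       & (E1Nt / (a * ln a `^ rho1)%:E
            <= ((nu * D * a * ln a `^ (rho1 - 1))^-1)%:E)%E]).
Proof.
split=> [rho1 a rho1_gt1 a1 d Omega Y P0 iid0|nu nu01].
  rewrite (_ : [set w | _] =
      [set w | (Ntilde pi a (sample_path Y w) <= (a * ln a `^ rho1)%:E)%E]).
    by apply: prob_Ntilde_le => //; lra.
  by apply/seteqP; split=> w /=; rewrite /delta_b; case: ifP.
have D0 := relative_entropy_gt0 mu_pmf pi_pmf pi_full mu_neq_pi.
have [astar ENt] := expectation_Ntilde_le_ln mu_pmf mu_full pi_full nu01 D0.
exists astar => a aa a1 rho1 rho1_gt1 d Omega Y P0 P1 iid0 iid1.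
move=> Nt N delta D E1Nt beta.
have nu0 : 0 < nu by case/andP: nu01.
have lna0 : 0 < ln a by exact: ln_gt0.
have b0 : 0 < a * ln a `^ rho1 by rewrite mulr_gt0 ?powR_gt0//; lra.
have mNt : measurable_fun setT Nt by exact: measurable_Ntilde iid1 _.
have mN : measurable_fun setT N by apply: measurable_mine => //.
have E1Nt_le : (E1Nt <= (ln a / (nu * D))%:E)%E by exact: ENt.
have N0 w : (0 <= N w)%E.
  by rewrite le_min Ntilde_ge0/= lee_fin ler0z floor_ge0 ltW.
have betaE : beta = P1 [set w | ((a * ln a `^ rho1)%:E < Nt w)%E].
  congr (P1 _); apply/seteqP; split=> w /=; rewrite /delta /delta_b ltNge;
    by case: ifP.
split; split => //.
- by apply: ge0_le_integral => // w _; rewrite /N /Nb ge_min lexx.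
- apply: (@le_trans _ _ (\int[P0]_w (cst (a * ln a `^ rho1)%:E w))%E).
    apply: ge0_le_integral => // w _.
    by rewrite ge_min lee_fin floor_le orbT.
  by rewrite integral_cst// [X in (_ * X)%E]probability_setT mule1.
- by rewrite betaE; apply: prob_gt_le_expectation => // w; exact: Ntilde_ge0.
- rewrite inver gt_eqF// lee_pdivrMr//; apply: (le_trans E1Nt_le).
  rewrite -EFinM lee_fin le_eqVlt; apply/orP; left; apply/eqP.
  have -> : ln a `^ rho1 = ln a `^ (rho1 - 1) * ln a.
    rewrite -[X in _ = _ * X](powRr1 (ltW lna0)) -powRD ?subrK//.
    by rewrite (gt_eqF lna0) implybT.
  have p0 : 0 < ln a `^ (rho1 - 1) by exact: powR_gt0.
  field; rewrite !gt_eqF//; lra.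
Qed.
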